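(* Let $G$ be an Abelian group and $\{a_n\}_{n\in\omega}$ a nontrivial $T$-sequence in $G$. Then the paratopological group $P(G|\{a_n\}_{n\in\omega})$ is not a Fréchet–Urysohn space.
   Context: A paratopological group topology is a topology making the group operation jointly continuous; a group topology is a topology making $G$ a topological group. All these topologies are assumed $T_1$ (so group topologies are Hausdorff). A sequence $\{a_n\}_{n\in\omega}$ in $G$ is a $T$-sequence (resp. $PT$-sequence) if there is a group topology (resp. paratopological group topology) on $G$ in which $\{a_n\}$ converges to $0$; every $T$-sequence is a $PT$-sequence. It is nontrivial if $a_n\neq 0$ for infinitely many $n$. $P(G|\{a_n\}_{n\in\omega})$ denotes $G$ endowed with the strongest (finest) paratopological group topology in which $\{a_n\}$ converges to $0$. A space $X$ is Fréchet–Urysohn if for each $A\subset X$ and $x\in\overline{A}$ there is a sequence in $A$ converging to $x$. *)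

(* Defs.v *)
From HB Require Import structures.
From mathcomp Require Import all_boot all_order all_algebra.
From mathcomp Require Import all_classical topology.

Set Implicit Arguments.
Unset Strict Implicit.
Unset Printing Implicit Defensive.

Import GRing.Theory.
Local Open Scope classical_set_scope.
Local Open Scope ring_scope.

(* [Topological G] is the type of all topologies on the fixed carrier [G]; one
   carrier bears several topologies below, so they are passed explicitly. *)
Definition tspace (G : Type) (tau : Topological G) : topologicalType :=
  Topological.Pack tau.

Definition finer (G : Type) (tau1 tau2 : Topological G) : Prop :=
  (@open (tspace tau2) : set (set G)) `<=` (@open (tspace tau1) : set (set G)).

Section GroupTopologies.
Variable G : zmodType.
Implicit Types (tau : Topological G) (a : nat -> G).

Definition paratopological_group_topology tau : Prop :=
  accessible_space (tspace tau) /\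
  continuous (fun z : tspace tau * tspace tau =>
                ((z.1 : G) + (z.2 : G) : tspace tau)).

Definition group_topology tau : Prop :=
  paratopological_group_topology tau /\
  continuous (fun x : tspace tau => (- (x : G) : tspace tau)).

Definition converges_to_0 tau a : Prop :=
  (a : nat -> tspace tau) @ \oo --> ((0 : G) : tspace tau).

Definition T_sequence a : Prop :=
  exists2 tau, group_topology tau & converges_to_0 tau a.

Definition PT_sequence a : Prop :=
  exists2 tau, paratopological_group_topology tau & converges_to_0 tau a.

Lemma T_sequence_PT a : T_sequence a -> PT_sequence a.
Proof. by move=> [tau [? _] ?]; exists tau. Qed.

Definition nontrivial_sequence a : Prop := infinite_set [set n | a n != 0].

Definition admissible a tau : Prop :=
  paratopological_group_topology tau /\ converges_to_0 tau a.

(* P(G|{a_n}): G with the supremum of all T1 paratopological group topologies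
   in which a converges to 0.  For a PT-sequence this supremum is itself such
   a topology, hence the strongest one; see [Pspace_strongest]. *)
Definition Pspace a : topologicalType :=
  sup_topology (fun tau : {tau : Topological G | admissible a tau} => sval tau).

Lemma Pspace_strongest a : PT_sequence a ->
  admissible a (Topological.class (Pspace a)) /\
  forall tau, admissible a tau -> finer (Topological.class (Pspace a)) tau.
Proof.
move=> [tau0 ptau0 ctau0].
have fin tau : admissible a tau -> finer (Topological.class (Pspace a)) tau.
  move=> adm; rewrite /finer /= => U oU.
  rewrite (@openE (Pspace a)) => x Ux.
  have /cvg_sup H : nbhs (x : Pspace a) --> (x : Pspace a) by [].
  apply: (H (exist _ tau adm)).
  by apply: (@open_nbhs_nbhs (tspace tau)); split.
have fcvg tau (adm : admissible a tau) (x : G) :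
    nbhs (x : Pspace a) --> (x : tspace tau).
  have /cvg_sup : nbhs (x : Pspace a) --> (x : Pspace a) by [].
  exact: (fun H => H (exist _ tau adm)).
split=> //; split; first split.
- move=> x y xy; have [+ _] := ptau0.
  have /= xy' : (x : tspace tau0) != y by apply: contra_neq xy.
  move=> /(_ _ _ xy') [A [oA xA yA]]; exists A; split=> //.
  exact: (fin tau0 (conj ptau0 ctau0)).
- move=> [x y]; apply/cvg_sup => i.
  have adm := svalP i; have [[_ /(_ (x, y))/= addc] _] := adm.
  apply: cvg_trans addc => W /= [[/= A B] [nA nB] AB].
  exists (A, B) => //; split.
    exact: (fcvg _ adm x A).
  exact: (fcvg _ adm y B).
- rewrite /converges_to_0; apply/cvg_sup => i.
  by have [_] := svalP i.
Qed.

End GroupTopologies.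

Definition Frechet_Urysohn (X : topologicalType) : Prop :=
  forall (A : set X) (x : X), closure A x ->
    exists2 u : nat -> X, (forall n, A (u n)) & u @ \oo --> x.

(* Main.v *)
(* Let tau be a Hausdorff group topology in which a converges to 0, and let B_n
   be the set of sums of at most n terms of a.  Each B_n is tau-closed and every
   tau-limit point of B_(n+1) lies in B_n.  A nonempty P-open set has no
   P-isolated points, so a descent on n shows that no B_n contains one.  Hence
   a_n <> 0 is in the P-closure of V_n \ B_n, where V_n is a tau-neighbourhood
   of a_n kept apart from 0, and 0 is in the P-closure of the union E of these
   sets.  A sequence in E that tends to 0 eventually leaves every V_n, hence
   every B_n, so the set Q of its late terms meets each B_n in a finite set.
   Since the B_n are closed, one chooses successively f 0, f 1, ... so that no
   sum of elements of the tails {0} u {a_i : i >= f k} falls in Q; these sums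
   form a P-neighbourhood of 0, a contradiction.  The same choice applied to a
   singleton Q shows that the topology generated by such sets is T1. *)
Require Import Defs.
From HB Require Import structures.
From mathcomp Require Import all_boot all_algebra.
From mathcomp Require Import all_classical topology.

Set Implicit Arguments.
Unset Strict Implicit.
Unset Printing Implicit Defensive.

Import GRing.Theory.
Local Open Scope classical_set_scope.
Local Open Scope ring_scope.

(** * Sums of terms from tails of the sequence, and the topology they generate *)

Section PartialSums.
Variables (G : zmodType) (a : nat -> G).
Implicit Types (f g : nat -> nat) (D Q : set G).

(** Containing 0 lets a sum skip a position, so [partial_sums f n] increases with [n]. *)
Definition tail m : set G :=
  [set e | e = 0 \/ exists2 i, (m <= i)%N & e = a i].

Definition add_tail D m : set G :=
  [set x | exists y e, [/\ D y, tail m e & x = y + e]].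

Fixpoint partial_sums f n : set G :=
  if n is n'.+1 then add_tail (partial_sums f n') (f n') else [set 0].

Lemma tail0 m : tail m 0. Proof. by left. Qed.

Lemma tailW m m' : (m <= m')%N -> tail m' `<=` tail m.
Proof.
by move=> mm' e [->|[i m'i ->]]; [left|right; exists i => //; exact: leq_trans m'i].
Qed.

Lemma sub_add_tail D m : D `<=` add_tail D m.
Proof. by move=> x Dx; exists x, 0; split=> //; [exact: tail0|rewrite addr0]. Qed.

Lemma add_tailS D D' m m' : (m' <= m)%N -> D `<=` D' ->
  add_tail D m `<=` add_tail D' m'.
Proof.
move=> mm' DD' x [y [e [Dy em ->]]]; exists y, e.
by split=> //; [exact: DD'|exact: tailW em].
Qed.

Lemma partial_sumsW f n n' : (n <= n')%N ->
  partial_sums f n `<=` partial_sums f n'.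
Proof.
move/subnK <-; elim: (n' - n)%N => // k IH x /IH.
exact: sub_add_tail.
Qed.

Lemma partial_sums_le f g n : (forall i, (f i <= g i)%N) ->
  partial_sums g n `<=` partial_sums f n.
Proof.
by move=> fg; elim: n => // n IH; exact: add_tailS.
Qed.

(** A term past this bound fits both positions [2i] and [2i+1] for [f], so two sums of length [n]
    interleave into one of length [2n]. *)
Definition interleave_bound f i := maxn (f i.*2) (f i.*2.+1).

Lemma partial_sumsD f n x y :
  partial_sums (interleave_bound f) n x ->
  partial_sums (interleave_bound f) n y -> partial_sums f n.*2 (x + y).
Proof.
elim: n x y => [|n IH] x y; first by move=> -> ->; rewrite /= addr0.
move=> [x' [d [x'n dn ->]]] [y' [e [y'n en ->]]].
rewrite doubleS; exists (x' + y' + d), e; split.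
- exists (x' + y'), d; split=> //; first exact: IH.
  by apply: tailW dn; rewrite leq_maxl.
- by apply: tailW en; rewrite leq_maxr.
- by rewrite addrACA addrA.
Qed.

(* The sets [\bigcup_n partial_sums f n] form a base at 0 of the finest, not
   necessarily T1, paratopological group topology in which [a] converges to 0. *)
Definition sum_nbhs (x : G) : set (set G) :=
  [set W | exists f, forall n y, partial_sums f n y -> W (x + y)].

(* The unused index makes the topology inferred on the alias depend on [a]. *)
Definition sum_space of nat -> G : Type := G.
Local Notation sumT := (sum_space a).

Lemma sum_nbhs_filter (x : G) : ProperFilter (sum_nbhs x).
Proof.
split; first by move=> [f /(_ 0%N 0)]; apply.
split.
- by exists (fun=> 0%N).
- move=> V W [f fV] [g gW]; exists (fun i => maxn (f i) (g i)) => n y ny; split.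
    by apply: (fV n); apply: partial_sums_le ny => i; rewrite leq_maxl.
  by apply: (gW n); apply: partial_sums_le ny => i; rewrite leq_maxr.
- by move=> V W VW [f fV]; exists f => n y /fV /VW.
Qed.

Lemma sum_nbhs_singleton (x : G) W : sum_nbhs x W -> W x.
Proof. by move=> [f /(_ 0%N 0 erefl)]; rewrite addr0. Qed.

Lemma sum_nbhs_add (x y : G) W : sum_nbhs (x + y) W ->
  exists U V, [/\ sum_nbhs x U, sum_nbhs y V &
    forall u v, U u -> V v -> W (u + v)].
Proof.
move=> [f fW]; pose g := interleave_bound f.
pose N z := [set w | exists n, partial_sums g n (w - z)].
have nN z : sum_nbhs z (N z) by exists g => n w nw; exists n; rewrite addrC addKr.
exists (N x), (N y); split=> // u v [m um] [n vn].
have -> : u + v = x + y + ((u - x) + (v - y)).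
  by rewrite addrACA !subrKC.
apply: (fW (maxn m n).*2).
by apply: partial_sumsD; [apply: partial_sumsW um|apply: partial_sumsW vn];
  rewrite ?leq_maxl ?leq_maxr.
Qed.

(** This is joint continuity of addition at [(x, 0)]. *)
Lemma sum_nbhs_nbhs (x : G) W : sum_nbhs x W -> sum_nbhs x (sum_nbhs^~ W).
Proof.
rewrite -[in sum_nbhs x W](addr0 x).
move=> /sum_nbhs_add[U [V [nU [f fV] UVW]]].
case: (sum_nbhs_filter x) => _ ?; apply: filterS nU => u Uu.
by exists f => n y /fV Vy; apply: UVW; rewrite // -[y]add0r.
Qed.

HB.instance Definition _ := Choice.on sumT.
HB.instance Definition _ := @hasNbhs.Build sumT sum_nbhs.
HB.instance Definition _ := @Nbhs_isNbhsTopological.Build sumT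
  sum_nbhs_filter sum_nbhs_singleton sum_nbhs_nbhs.

Definition sum_topology : Topological G := Topological.class sumT.

End PartialSums.

(** * Partial sums in a Hausdorff group topology *)

Section GroupTopology.
Variables (G : zmodType) (a : nat -> G) (tau : Topological G).
Hypotheses (gtau : group_topology tau) (cvga : converges_to_0 tau a).
Implicit Types (x y : G) (D Q W : set G).
Local Notation T := (tspace tau).

Lemma nbhs_neq x y : x != y -> \forall w \near (x : T), w != y.
Proof.
move=> xy; have xyT : (x : T) != y by apply: contra_neq xy.
have [U [oU]] := gtau.1.1 x y xyT; rewrite !in_setE => xU yU.
have : nbhs (x : T) U by exact: open_nbhs_nbhs.
by apply: filterS => w Uw; apply: contra_notN yU => /eqP <-.
Qed.

Lemma nbhs_sub x y W : nbhs ((x - y : G) : T) W ->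
  exists U V, [/\ nbhs (x : T) U, nbhs (y : T) V &
    forall u v, U u -> V v -> W (u - v)].
Proof.
move=> /(gtau.1.2 (x, - y))[[U V] /= [nU nV] UVW].
exists U, (fun v : G => V (- v)); split=> //; first exact: gtau.2 nV.
by move=> u v Uu Vv; exact: (UVW (u, - v)).
Qed.

Lemma near_subl x y W : nbhs ((x - y : G) : T) W ->
  \forall w \near (x : T), W (w - y).
Proof.
move=> /nbhs_sub[U [V [nU nV UVW]]]; apply: filterS nU => u Uu.
by apply: UVW => //; exact: (@nbhs_singleton T y).
Qed.

(** Convergence puts a whole tail into one neighbourhood of 0; this leaves only finitely many terms
    to treat one by one below. *)
Lemma near_sub_tail x W : nbhs (x : T) W ->
  exists m, \forall w \near (x : T), forall e, tail a m e -> W (w - e).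
Proof.
rewrite -[in nbhs _ _](subr0 x) => /nbhs_sub[U [V [nU nV UVW]]].
have [m _ mV] := cvga nV; exists m; apply: filterS nU => u Uu e.
case=> [->|[i mi ->]]; apply: UVW => //; last exact: mV.
exact: (@nbhs_singleton T 0).
Qed.

Lemma separated_nbhs x y : x != y ->
  exists U V, [/\ nbhs (x : T) U, nbhs (y : T) V & forall z, U z -> ~ V z].
Proof.
rewrite -subr_eq0 => /nbhs_neq /nbhs_sub[U [V [nU nV UVW]]].
by exists U, V; split=> // z Uz /(UVW _ _ Uz); rewrite subrr eqxx.
Qed.

Lemma closedP D :
  @closed T D <-> forall x, ~ D x -> \forall w \near (x : T), ~ D w.
Proof. by rewrite -openC openE. Qed.

(** Near [x], terms from [M] on are excluded all at once, and each earlier [a i] by translating the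
    open complement of [D]. *)
Lemma closed_add_tail D m : @closed T D -> @closed T (add_tail a D m).
Proof.
move=> /closedP clD; apply/closedP => x xD.
have [|M] := near_sub_tail (clD x _); first by move=> /(@sub_add_tail _ a _ m).
move=> far.
have near_i (i : 'I_M) : \forall w \near (x : T), (m <= i)%N -> ~ D (w - a i).
  have [mi|_] := leqP m i; last exact: filterE.
  have /clD : ~ D (x - a i).
    move=> Di; apply: xD; exists (x - a i), (a i); split=> //; last by rewrite subrK.
    by right; exists i.
  by move=> /near_subl; apply: filterS.
apply: filterS2 far (filter_forall _ near_i) => w wfar wi.
move=> [y [e [Dy [->|[i mi ->]] wye]]].
  by apply: (wfar 0); [exact: tail0|rewrite wye addr0 subr0].
have [iM|Mi] := ltnP i M.
  by apply: (wi (Ordinal iM)) => //=; rewrite wye addrK.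
by apply: (wfar (a i)); [right; exists i|rewrite wye addrK].
Qed.

Lemma closed_partial_sums f n : @closed T (partial_sums a f n).
Proof.
elim: n => [|n IH]; last exact: closed_add_tail.
by apply/closedP => x /eqP /nbhs_neq; apply: filterS => w /eqP.
Qed.

Local Notation B := (partial_sums a (fun=> 0%N)).

(** For [x] outside [B n], a point of [B n.+1] near [x] is [y + a i] with [y] in [B n] and [i < M];
    induction applies at each [x - a i]. The guard [0 < n] leaves the base case unconditional. *)
Lemma partial_sums_isolated n x : ((0 < n)%N -> ~ B n.-1 x) ->
  \forall w \near (x : T), B n w -> w = x.
Proof.
elim: n x => [|n IH] x xB.
  have [->|/nbhs_neq] := eqVneq x 0; first exact: filterE.
  by apply: filterS => w /eqP w0 /w0.
have {}xB := xB erefl.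
have [M far] := near_sub_tail ((closedP _).1 (@closed_partial_sums _ n) x xB).
have near_i (i : 'I_M) : \forall w \near (x : T), B n (w - a i) -> w = x.
  have : (0 < n)%N -> ~ B n.-1 (x - a i).
    case: n {IH far} xB => //= n xB _ Di; apply: xB.
    exists (x - a i), (a i); split=> //; last by rewrite subrK.
    by right; exists i.
  move=> /IH /near_subl; apply: filterS => w wx /wx.
  by move/(congr1 (+%R^~ (a i))); rewrite !subrK.
apply: filterS2 far (filter_forall _ near_i) => w wfar wi.
move=> [y [e [By [e0|[i _ ei]] wye]]].
  by case: (wfar 0); [exact: tail0|rewrite wye e0 addr0 subr0].
have [iM|Mi] := ltnP i M.
  by apply: (wi (Ordinal iM)) => //=; rewrite wye ei addrK.
by case: (wfar (a i)); [right; exists i|rewrite wye ei addrK].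
Qed.

(** Only the finitely many [q] of [Q] in [B n.+1] can be hit. Each lies outside the closed [D], and
    so does [q - e] for [e] in a far tail. *)
Lemma add_tail_avoid D Q n : @closed T D -> D `<=` B n ->
  (forall x, D x -> ~ Q x) -> finite_set (Q `&` B n.+1) ->
  exists m, forall x, add_tail a D m x -> ~ Q x.
Proof.
move=> clD DB DQ /finite_seqP[s sE].
have [m ms] : exists m, forall q, q \in s -> Q q -> forall e, tail a m e -> ~ D (q - e).
  elim: s {sE} => [|q s [m ms]]; first by exists 0%N.
  have [Qq|nQq] := pselect (Q q); last first.
    by exists m => q'; rewrite inE => /predU1P[-> /nQq|/ms].
  have qD : ~ D q by move/DQ.
  have [k /nbhs_singleton kq] := near_sub_tail ((closedP _).1 clD q qD).
  exists (maxn m k) => q'; rewrite inE => /predU1P[->|q's] Qq' e em.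
    by apply: kq; apply: tailW em; rewrite leq_maxr.
  by apply: ms => //; apply: tailW em; rewrite leq_maxl.
exists m => x [y [e [Dy em xye]]] Qx.
have xs : x \in s.
  have : (Q `&` B n.+1) x.
    by split=> //; exists y, e; split=> //; [exact: DB|exact: tailW em].
  by rewrite sE.
by apply: (ms x xs Qx e em); rewrite xye addrK.
Qed.

Lemma partial_sums_avoid Q : ~ Q 0 -> (forall n, finite_set (Q `&` B n)) ->
  exists f, forall n x, partial_sums a f n x -> ~ Q x.
Proof.
move=> Q0 Qfin.
(* The conditional form covers every set [D], so that [choice] gives a total function; 0 is the
   default. *)
have avoid_step D : exists m,
    (exists n, [/\ @closed T D, D `<=` B n & forall x, D x -> ~ Q x]) ->
    forall x, add_tail a D m x -> ~ Q x.
  have [[n [clD DB DQ]]|?] := pselect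
    (exists n, [/\ @closed T D, D `<=` B n & forall x, D x -> ~ Q x]).
    by have [m mP] := add_tail_avoid clD DB DQ (Qfin n.+1); exists m.
  by exists 0%N.
have [pick pickP] := choice avoid_step.
pose D := fix D n := if n is n'.+1 then add_tail a (D n') (pick (D n')) else [set 0].
have DE n : D n = partial_sums a (fun i => pick (D i)) n.
  by elim: n => //= n ->.
exists (fun i => pick (D i)) => n; rewrite -DE.
elim: n => [|n IH] x; first by move=> ->.
apply: (pickP (D n)); exists n; rewrite DE; split.
- exact: closed_partial_sums.
- exact: partial_sums_le.
- by rewrite -DE.
Qed.

Lemma sum_topology_admissible : admissible a (sum_topology a).
Proof.
split; first split.
- move=> x y xy.
  exists [set z : G | z != y]; split; rewrite ?in_setE //=; last by rewrite eqxx.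
  rewrite openE => z /= zy.
  have [||f fP] := @partial_sums_avoid [set y - z].
  + by move=> /esym/eqP; rewrite subr_eq0 eq_sym (negPf zy).
  + by move=> n; apply: sub_finite_set (finite_set1 (y - z)); exact: subIsetl.
  + exists f => n w /fP /= wyz; apply/negP => /eqP zwy.
    by apply: wyz; rewrite -zwy addrC addKr.
- move=> [x y] W /sum_nbhs_add[U [V [nU nV UVW]]].
  by exists (U, V) => // -[u v] /= [Uu Vv]; exact: UVW.
- move=> W [f fW]; exists (f 0%N) => // i fi /=.
  rewrite -[a i]add0r; apply: (fW 1%N); exists 0, (a i).
  by split=> //; [right; exists i|rewrite add0r].
Qed.

End GroupTopology.

(** * Neighbourhoods in [Pspace a] and the contradiction *)

Lemma nbhs_Pspace (G : zmodType) (a : nat -> G) (tau : Topological G) x W :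
  admissible a tau -> nbhs (x : tspace tau) W -> nbhs (x : Pspace a) W.
Proof.
move=> adm; have PT : PT_sequence a by exists tau; case: adm.
rewrite nbhsE => -[U [oU Ux] UW].
apply: (@filterS _ _ (nbhs_filter (x : Pspace a)) _ _ UW).
apply: (@open_nbhs_nbhs (Pspace a) x U); split=> //.
exact: (Pspace_strongest PT).2 oU.
Qed.

Lemma nontrivial_unbounded (G : zmodType) (a : nat -> G) m :
  nontrivial_sequence a -> exists2 n, (m <= n)%N & a n != 0.
Proof.
move=> nta; apply: contrapT => nex; apply: nta.
apply: sub_finite_set (finite_II m) => i /= ai.
by rewrite ltnNge; apply/negP => mi; apply: nex; exists i.
Qed.

Lemma Pspace_nbhs_not_sub (G : zmodType) (a : nat -> G) (tau : Topological G) n Z x :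
  group_topology tau -> converges_to_0 tau a -> nontrivial_sequence a ->
  nbhs (x : Pspace a) Z -> ~ Z `<=` partial_sums a (fun=> 0%N) n.
Proof.
move=> gtau cvga nta; rewrite nbhsE => -[U [oU Ux] UZ] /(subset_trans UZ).
have adm : admissible a tau by split; case: gtau.
have PT : PT_sequence a by exists tau; case: adm.
have [[[_ addP] cvgP] _] := Pspace_strongest PT.
have movable y W : nbhs (y : Pspace a) W -> exists2 w, W w & w != y.
  rewrite -[in nbhs _ _](addr0 y) => /(addP (y, 0))[[V V'] /= [nV nV'] VW].
  have [m _ mV'] := cvgP _ nV'.
  have [i mi ai] := nontrivial_unbounded m nta.
  exists (y + a i); last by rewrite -subr_eq0 addrC addKr.
  by apply: (VW (y, a i)); split=> /=; [exact: (@nbhs_singleton (Pspace a))|exact: mV'].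
have UN : forall y, U y -> nbhs (y : Pspace a) U by rewrite openE in oU.
elim: n => [|n IH] UB; last apply: IH => y Uy.
  have [w Uw /eqP] := movable x U (UN x Ux).
  by rewrite (UB _ Uw) (UB _ Ux).
(* Outside [B n], [y] would be isolated in [B n.+1], hence in [U], against [movable]. *)
apply: contrapT => yB.
have /(nbhs_Pspace adm) : \forall w \near (y : tspace tau),
    partial_sums a (fun=> 0%N) n.+1 w -> w = y.
  exact: (partial_sums_isolated gtau cvga).
by move=> /(filterI (UN y Uy)) /movable[w [/UB Bw /(_ Bw)] -> /eqP].
Qed.

Theorem corollary5p16 (G : zmodType) (a : nat -> G) :
  T_sequence a -> nontrivial_sequence a -> ~ Frechet_Urysohn (Pspace a).
Proof.
move=> [tau gtau cvga] nta FU.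
have adm : admissible a tau by split; case: gtau.
have PT : PT_sequence a by exists tau; case: adm.
have [[_ cvgP] _] := Pspace_strongest PT.
pose B := partial_sums a (fun=> 0%N).
(* The pair of empty sets is a dummy value for indices with [a n = 0]. *)
have separate n : exists V : set G * set G, a n != 0 ->
    [/\ nbhs (a n : tspace tau) V.1, nbhs ((0 : G) : tspace tau) V.2 &
        forall z, V.1 z -> ~ V.2 z].
  have [->|an] := eqVneq (a n) 0; first by exists (set0, set0).
  by have [U [V]] := separated_nbhs gtau an; exists (U, V).
have [V VP] := choice separate.
pose E : set (Pspace a) := [set z | exists n, [/\ a n != 0, (V n).1 z & ~ B n z]].
have clE : closure E (0 : G).
  move=> W; rewrite nbhsE => -[O [oO O0] OW].
  have nO : nbhs (0 : Pspace a) O by exact: open_nbhs_nbhs.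
  have [m _ mO] := cvgP _ nO.
  have [n mn an] := nontrivial_unbounded m nta.
  have nOV : nbhs (a n : Pspace a) (O `&` (V n).1).
    apply: filterI; last by apply: (nbhs_Pspace adm); have [] := VP n an.
    by apply: open_nbhs_nbhs; split=> //; exact: mO.
  have /existsNP[z /not_implyP[[Oz Vz] nBz]] :=
    Pspace_nbhs_not_sub (n := n) gtau cvga nta nOV.
  by exists z; split; [exists n|exact: OW].
have [u uE u0] := FU E 0 clE.
(* Each piece of [E] stays away from 0, so late terms lie in late pieces. *)
have late N : exists K, forall k, (K <= k)%N -> ~ B N (u k).
  have /u0[K _ KP] : nbhs (0 : Pspace a)
      [set z | forall i : 'I_N, a i != 0 -> (V i).2 z].
    apply: (nbhs_Pspace adm).
    apply: (@filter_forall _ _ _ _ (nbhs_filter ((0 : G) : tspace tau))) => i.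
    have [ai0|ai] := eqVneq (a i) 0.
      by apply: (@filterE _ _ (nbhs_filter ((0 : G) : tspace tau))) => z.
    have [_ + _] := VP i ai.
    by apply: (@filterS _ _ (nbhs_filter ((0 : G) : tspace tau))) => z.
  exists K => k Kk BN; have [n [an Vn nB]] := uE k.
  have [nN|Nn] := ltnP n N; last by apply: nB; exact: partial_sumsW BN.
  by have [_ _ /(_ _ Vn)] := VP n an; apply; exact: (KP k Kk (Ordinal nN)).
(* As [B 0] is [{0}], the terms from [K] on are nonzero, which keeps 0 out of [Q]. *)
have [K KP] := late 0%N.
pose Q : set G := [set z | exists2 k, (K <= k)%N & z = u k].
have [||f fQ] := partial_sums_avoid gtau cvga (Q := Q).
- by move=> [k Kk uk]; apply: (KP k Kk); rewrite -uk.
- move=> N; have [K' K'P] := late N.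
  apply: sub_finite_set (finite_image u (finite_II K')) => z [[k _ ->] BN].
  exists k => //=; rewrite ltnNge; apply/negP => /K'P; exact.
(* The complement of [Q] is now a neighbourhood of 0, yet [Q] holds every [u k] with [k >= K]. *)
have [|k0 _ k0P] := u0 (~` Q).
  apply: (nbhs_Pspace (sum_topology_admissible gtau cvga)).
  by exists f => n y /fQ; rewrite add0r.
apply: (k0P (maxn k0 K)); first by rewrite /= leq_maxl.
by exists (maxn k0 K); rewrite // leq_maxr.
Qed.
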